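(* Let $G$ be a group given by a finite presentation $\mathcal P=\langle X\mid R\rangle$ with cyclically reduced relators, and let $m:R\to\mathbb Z_{>0}$ be a multiplicity function such that $\mathcal P$ has the $m$-matching property. Suppose that every word in $X^{\pm1}$ representing $1\in G$ can be reduced to the empty word by a finite sequence of moves, each of which is either a (cyclic) free reduction, or the replacement of a subword of a relator $r$ by its complement $\sigma$ subject to the inequality $$n\cdot m(r)\ge |\sigma|,$$ where $n$ is the exponent of $r$. Then $G$ is coherent.
   Context: The incidence graph of $\mathcal P=\langle X\mid R\rangle$ is the bipartite graph with vertex set $R\sqcup X$ in which $r\in R$ and $x\in X$ are joined by an edge iff $x$ (or $x^{-1}$) occurs in the spelling of $r$. Given $m:R\to\mathbb Z_{>0}$, $\mathcal P$ has the $m$-matching property if for every subset $W\subseteq R$ the number of generators occurring in some relator of $W$ is at least $\sum_{r\in W}m(r)$. The exponent of a relator $r$ is the largest $n$ such that $r=u^n$ for some word $u$. Replacing a subword by its complement means: if some cyclic permutation of $r$ or $r^{-1}$ equals $uv$ and the current word contains $u$ as a subword, replace $u$ by $\sigma=v^{-1}$ (so $|\sigma|=|r|-|u|$). A group is coherent if every finitely generated subgroup is finitely presented. *)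

(* Defs.v *)
From Stdlib Require Import Relations.
From mathcomp Require Import all_boot.
Set Implicit Arguments. Unset Strict Implicit. Unset Printing Implicit Defensive.

(* A letter over alphabet A is (x, b): b = false means x, b = true means x^-1. *)
Definition word (A : Type) := seq (A * bool).

Definition linv {A : Type} (l : A * bool) : A * bool := (l.1, ~~ l.2).
Definition winv {A : Type} (w : word A) : word A := rev (map linv w).

Definition reduced {A : Type} (w : word A) : Prop :=
  ~ exists (a b : word A) (l : A * bool), w = a ++ l :: linv l :: b.

Definition cyc_reduced {A : Type} (w : word A) : Prop :=
  reduced w /\ ~ exists (a : word A) (l : A * bool), w = l :: rcons a (linv l).

Definition is_exponent {A : Type} (r : word A) (n : nat) : Prop :=
  (exists u : word A, r = flatten (nseq n u)) /\
  (forall (n' : nat) (u : word A), r = flatten (nseq n' u) -> n' <= n).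

Inductive gstep {A : eqType} (S : seq (word A)) : word A -> word A -> Prop :=
| gs_free (a b : word A) (l : A * bool) : gstep S (a ++ b) (a ++ l :: linv l :: b)
| gs_rel (a b r : word A) : r \in S -> gstep S (a ++ b) (a ++ r ++ b).

Definition grp_eq {A : eqType} (S : seq (word A)) : relation (word A) :=
  clos_refl_sym_trans (word A) (gstep S).

Definition subst {B A : Type} (phi : B -> word A) (u : word B) : word A :=
  flatten (map (fun l => if l.2 then winv (phi l.1) else phi l.1) u).

Definition in_subgroup {A : eqType} (S : seq (word A)) (k : nat)
  (h : 'I_k -> word A) (w : word A) : Prop :=
  exists u : word 'I_k, grp_eq S w (subst h u).

(* The subgroup generated by h is finitely presented: there is a finite
   presentation <'I_k' | S'> and a homomorphism y |-> phi y into the subgroup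
   which is surjective onto it and whose kernel is exactly the normal closure
   of S', i.e. an isomorphism <'I_k' | S'> ~= <h>. *)
Definition fp_subgroup {A : eqType} (S : seq (word A)) (k : nat)
  (h : 'I_k -> word A) : Prop :=
  exists (k' : nat) (S' : seq (word 'I_k')) (phi : 'I_k' -> word A),
    (forall y, in_subgroup S h (phi y)) /\
    (forall i, exists u : word 'I_k', grp_eq S (h i) (subst phi u)) /\
    (forall u : word 'I_k', grp_eq S (subst phi u) [::] <-> grp_eq S' u [::]).

Definition coherent {A : eqType} (S : seq (word A)) : Prop :=
  forall (k : nat) (h : 'I_k -> word A), fp_subgroup S h.

Definition matching {X I : finType} (rel : I -> word X) (m : I -> nat) : Prop :=
  forall W : {set I},
    \sum_(i in W) m i <= #|[set x : X | [exists i in W, x \in map fst (rel i)]]|.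

Inductive move {X I : finType} (rel : I -> word X) (m : I -> nat)
  : word X -> word X -> Prop :=
| mv_free (a b : word X) (l : X * bool) : move rel m (a ++ l :: linv l :: b) (a ++ b)
| mv_cyc (a : word X) (l : X * bool) : move rel m (l :: rcons a (linv l)) a
| mv_rel (i : I) (n j : nat) (a b u v : word X) :
    is_exponent (rel i) n ->
    (rot j (rel i) = u ++ v \/ rot j (winv (rel i)) = u ++ v) ->
    size (winv v) <= n * m i ->
    move rel m (a ++ u ++ b) (a ++ winv v ++ b).

(* Main.v *)
Require Import Defs.
From Stdlib Require Import Relations Setoid Morphisms.
From mathcomp Require Import all_boot.
From mathcomp Require Import boolp.
Set Implicit Arguments. Unset Strict Implicit. Unset Printing Implicit Defensive.

(** Let [H] be a finitely generated subgroup and let the free group act on the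
   cosets of [H]; a finite subgraph of the Schreier graph is a finite list [Y] of
   edges (coset, generator).  By Hall's theorem each relator [i] owns a set of
   at least [m i] generators occurring in it, these sets being disjoint.  The
   perimeter of [Y] counts the edges of [Y] whose label is owned by some [i] and
   for which the copy of relator [i] having the first occurrence of that label
   on this edge is not contained in [Y].

   Take [Y] of minimal perimeter among the finite subgraphs containing the loops
   of the generators of [H].  If [Y] contains a subword of a copy of relator [i]
   whose complement has length at most [n * m i], adding the complement does not
   increase the perimeter.  By minimality it stays the same, and this equality
   forces every added edge to be new and traversed once, and no other copy of a
   relator to be completed.  Up to homotopy [Y] is then unchanged: an assignment
   of group elements to the edges of [Y] that is trivial along the relators
   contained in [Y] extends to the added edges.  Following the moves that reduce
   a loop to the empty word, every loop of [Y] that is trivial in the group has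
   trivial holonomy for all such assignments.  Hence [H] is presented by the
   edges of [Y] reachable from the base point, modulo the paths of a spanning
   family and the finitely many relator loops in [Y]. *)

(** * Formal inverses of words *)

Section Words.
Variable A : Type.
Implicit Types (l : A * bool) (w : word A).

Lemma linvK : involutive (@linv A).
Proof. by case=> x b; rewrite /linv /= negbK. Qed.

Lemma winv_cat w1 w2 : winv (w1 ++ w2) = winv w2 ++ winv w1.
Proof. by rewrite /winv map_cat rev_cat. Qed.

Lemma winv_cons l w : winv (l :: w) = winv w ++ [:: linv l].
Proof. by rewrite -cat1s winv_cat. Qed.

Lemma winvK : involutive (@winv A).
Proof. by move=> w; rewrite /winv map_rev revK mapK //; apply: linvK. Qed.

Lemma size_winv w : size (winv w) = size w.
Proof. by rewrite /winv size_rev size_map. Qed.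

End Words.

#[export] Hint Extern 0 (grp_eq _ _ _) => reflexivity : core.

(** * The congruence defined by a presentation, and substitutions *)

Section Presentation.
Variables (A : eqType) (S : seq (word A)).
Implicit Types a b c w : word A.

Global Instance grp_eq_equiv : Equivalence (@grp_eq A S).
Proof.
split; first by move=> a; apply: rst_refl.
- by move=> a b; apply: rst_sym.
- by move=> a b c; apply: rst_trans.
Qed.

Lemma grp_eq_ctx c d a b : grp_eq S a b -> grp_eq S (c ++ a ++ d) (c ++ b ++ d).
Proof.
elim=> {a b} [a b ab|a|a b _ ih|a b e _ ih1 _ ih2].
- apply: rst_step; case: ab => [a' b' l|a' b' r rS].
    by rewrite -catA catA -!catA [c ++ _]catA [c ++ a' ++ _]catA; constructor.
  by rewrite -!catA [c ++ _]catA [c ++ a' ++ _]catA; constructor.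
- exact: rst_refl.
- exact: rst_sym.
- exact: rst_trans ih1 ih2.
Qed.

Global Instance grp_eq_cat :
  Proper (@grp_eq A S ==> @grp_eq A S ==> @grp_eq A S) (@cat (A * bool)).
Proof.
move=> a a' aa' b b' bb'; transitivity (a' ++ b).
  exact: (grp_eq_ctx [::] b aa').
by have := grp_eq_ctx a' [::] bb'; rewrite !cats0.
Qed.

Global Instance grp_eq_cons (l : A * bool) :
  Proper (@grp_eq A S ==> @grp_eq A S) (@cons (A * bool) l).
Proof. by move=> a b ab; rewrite -(cat1s l a) -(cat1s l b) ab. Qed.

Lemma grp_mulwV w : grp_eq S (w ++ winv w) [::].
Proof.
elim: w => [|l w ih]; first by reflexivity.
rewrite winv_cons -cat1s -catA [w ++ _]catA.
apply: (rst_trans _ _ _ _ _ (grp_eq_ctx [:: l] [:: linv l] ih)).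
by apply: rst_sym; apply: rst_step; apply: (gs_free S [::] [::] l).
Qed.

Lemma grp_mulVw w : grp_eq S (winv w ++ w) [::].
Proof. by rewrite -{2}[w]winvK; apply: grp_mulwV. Qed.

Lemma grp_mulKw w a : grp_eq S (winv w ++ w ++ a) a.
Proof. by rewrite catA grp_mulVw. Qed.

Lemma grp_mulVKw w a : grp_eq S (w ++ winv w ++ a) a.
Proof. by rewrite catA grp_mulwV. Qed.

Lemma grp_eq_mul1V a b : grp_eq S (a ++ winv b) [::] <-> grp_eq S a b.
Proof.
split=> h; last by rewrite h grp_mulwV.
by rewrite -[a]cats0 -(grp_mulVw b) catA h.
Qed.

Global Instance grp_eq_winv : Proper (@grp_eq A S ==> @grp_eq A S) (@winv A).
Proof.
move=> a b ab; apply/grp_eq_mul1V.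
by rewrite winvK -ab grp_mulVw.
Qed.

Lemma grp_eq_conj a b : grp_eq S (a ++ b) [::] -> grp_eq S (b ++ a) [::].
Proof.
move=> h; rewrite -[b ++ a](cat0s) -(grp_mulVw a) -catA [a ++ b ++ a]catA h.
by rewrite grp_mulVw.
Qed.

End Presentation.

Lemma winv_subst (B A : Type) (phi : B -> word A) u :
  subst phi (winv u) = winv (subst phi u).
Proof.
elim: u => [|l u ih] //=; rewrite winv_cons /subst map_cat flatten_cat -/(subst phi (winv u)).
rewrite ih /= cats0 winv_cat -/(subst phi u).
by case: l => b [] /=; rewrite ?winvK.
Qed.

Lemma subst_cat (B A : Type) (phi : B -> word A) u v :
  subst phi (u ++ v) = subst phi u ++ subst phi v.
Proof. by rewrite /subst map_cat flatten_cat. Qed.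

(** This is von Dyck's theorem: [subst] respects free cancellation automatically, so only the
    relators have to be checked. *)
Lemma subst_grp_eq (B A : eqType) (T : seq (word B)) (S : seq (word A))
    (phi : B -> word A) :
  (forall r, r \in T -> grp_eq S (subst phi r) [::]) ->
  forall u v, grp_eq T u v -> grp_eq S (subst phi u) (subst phi v).
Proof.
move=> phiT u v; elim=> {u v} [u v uv|u|u v _ ih|u v w _ ih1 _ ih2].
- case: uv => [a b l|a b r rT]; last by rewrite !subst_cat (phiT r).
  rewrite -[l :: linv l :: b]/([:: l] ++ winv [:: l] ++ b).
  by rewrite !subst_cat winv_subst grp_mulVKw.
- by reflexivity.
- by symmetry.
- by transitivity (subst phi v).
Qed.


(** * Hall's theorem and the assignment of generators to relators *)

(* Rado's argument: a family of sets that is minimal subject to Hall's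
   condition consists of singletons. *)
Lemma hall_marriage (I X : finType) (N : I -> {set X}) :
  (forall W : {set I}, #|W| <= #|\bigcup_(i in W) N i|) ->
  exists f : I -> X, injective f /\ forall i, f i \in N i.
Proof.
move=> hN.
pose ok (A : {ffun I -> {set X}}) := [forall i, A i \subset N i] &&
  [forall W : {set I}, #|W| <= #|\bigcup_(i in W) A i|].
have ok0 : ok [ffun i => N i].
  apply/andP; split; first by apply/forallP=> i; rewrite ffunE.
  by apply/forallP=> W; under eq_bigr do rewrite ffunE.
case: (arg_minnP (fun A : {ffun I -> {set X}} => \sum_i #|A i|) ok0) => A.
case/andP=> /forallP AN /forallP hA minA.
(* By minimality, deleting [x] from [A i] violates Hall's condition at some set, which must contain
   [i]; [W] is that set without [i]. *)
have cover_except i x (xA : x \in A i) (A1 : #|A i| > 1) : exists2 W : {set I},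
    i \notin W & #|(A i :\ x) :|: \bigcup_(j in W) A j| <= #|W|.
  pose A' := [ffun j => if j == i then A i :\ x else A j].
  have : ~~ ok A'.
    apply/negP=> /minA; rewrite leqNgt => /negP; apply.
    rewrite (bigD1 i) //= [ltnRHS](bigD1 i) //= ffunE eqxx.
    rewrite (eq_bigr (fun j => #|A j|)) => [|j /negPf ji]; last by rewrite ffunE ji.
    by rewrite ltn_add2r [ltnRHS](cardsD1 x) xA.
  rewrite negb_and => /orP[/forallPn[j]|/forallPn[W]].
    rewrite ffunE; case: eqP => [->|_]; last by rewrite AN.
    by rewrite (subset_trans (subsetDl _ _)).
  rewrite -ltnNge => WA'.
  have iW : i \in W.
    apply: contraLR WA' => iW; rewrite -leqNgt (leq_trans (hA W)) //.
    rewrite (eq_bigr A') // => j jW; rewrite ffunE; case: eqP jW => // ->.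
    by rewrite (negPf iW).
  exists (W :\ i); first by rewrite !inE eqxx.
  rewrite -ltnS [X in _ < X](_ : _ = #|W|); last by rewrite (cardsD1 i W) iW.
  apply: leq_ltn_trans WA'; rewrite [in leqRHS](bigD1 i) //= ffunE eqxx.
  apply: subset_leq_card; apply: setUS.
  apply/bigcupsP=> j; rewrite !inE => /andP[ji jW].
  apply: (bigcup_max j); first by rewrite jW.
  by rewrite ffunE (negPf ji).
have A1 i : #|A i| = 1.
  apply/eqP; rewrite eqn_leq; apply/andP; split; last first.
    by have := hA [set i]; rewrite cards1 big_set1.
  rewrite leqNgt; apply/negP=> Ai1.
  case/card_gt1P: (Ai1) => x [y [xA yA xy]].
  have [W1 iW1 c1] := cover_except _ _ xA Ai1.
  have [W2 iW2 c2] := cover_except _ _ yA Ai1.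
  (* Inclusion-exclusion: as [x] and [y] differ, the union of the two covers contains the neighbours
     of [i |: (W1 :|: W2)], and their intersection those of [W1 :&: W2]. Hall's condition for these
     two sets contradicts the sum of [c1] and [c2]. *)
  have := leq_add c1 c2; rewrite -(cardsUI W1 W2) -cardsUI leqNgt => /negP; apply.
  rewrite -addSn; apply: leq_add.
    have -> : #|W1 :|: W2|.+1 = #|i |: (W1 :|: W2)|.
      by rewrite cardsU1 !inE negb_or iW1 iW2.
    apply: (leq_trans (hA _)); apply/subset_leq_card/bigcupsP=> j.
    rewrite !inE => /or3P[/eqP->|jW|jW]; apply/subsetP=> u uA; rewrite !inE.
    - by rewrite uA !andbT; case: (u =P x) => [->|//]; rewrite xy !orbT.
    - by have -> : u \in \bigcup_(j in W1) A j; [apply/bigcupP; exists j | rewrite !orbT].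
    - by have -> : u \in \bigcup_(j in W2) A j; [apply/bigcupP; exists j | rewrite !orbT].
  apply: (leq_trans (hA _)); apply/subset_leq_card/bigcupsP=> j.
  rewrite !inE => /andP[j1 j2]; apply/subsetP=> u uA; rewrite !inE.
  by apply/andP; split; apply/orP; right; apply/bigcupP; exists j.
have /fin_all_exists[f Af] i : exists x, A i = [set x].
  by apply/cards1P; rewrite A1.
exists f; split=> [i j fij|i]; last first.
  by apply: (subsetP (AN i)); rewrite Af set11.
apply/eqP; apply: contraT => ij; have := hA [set i; j].
by rewrite cards2 ij bigcup_setU !big_set1 !Af fij setUid cards1.
Qed.

(** Hall's theorem is applied to [m i] copies of each relator [i]; a set of copies is no larger than
    the sum of [m] over the relators involved. *)
Lemma matching_assignment (I X : finType) (rel : I -> word X) (m : I -> nat) : matching rel m ->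
  exists g : X -> option I,
    (forall x i, g x = Some i -> x \in map fst (rel i)) /\
    (forall i, m i <= #|[set x | g x == Some i]|).
Proof.
move=> hm.
pose N (p : {i : I & 'I_(m i)}) := [set x in map fst (rel (tag p))].
have [|f [f_inj fN]] := @hall_marriage _ _ N.
move=> W; set W0 := [set tag p | p in W].
have le1 : #|W| <= \sum_(i in W0) m i.
  rewrite -sum1_card (partition_big tag (mem W0)) /=; last first.
    by move=> p pW; apply: imset_f.
  apply: leq_sum => i _; rewrite sum1_card -[leqRHS](card_ord (m i)).
  rewrite -(@card_imset _ _ (Tagged (fun i => 'I_(m i)))); last first.
    by move=> a b /eqP; rewrite eq_Tagged => /eqP.
  apply/subset_leq_card/subsetP=> -[j k] /andP[_ /eqP /= ji].
  by move: k; rewrite ji => k; apply: imset_f.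
apply: leq_trans le1 _; apply: leq_trans (hm W0) _.
apply/subset_leq_card/subsetP=> x; rewrite inE => /existsP[i /andP[/imsetP[p pW ->]]] xr.
by apply/bigcupP; exists p; rewrite // inE.
pose g x := omap tag [pick p | f p == x].
have gf p : g (f p) = Some (tag p).
  rewrite /g; case: pickP => [p' /eqP/f_inj -> //|/(_ p)]; by rewrite eqxx.
exists g; split=> [x i|i].
  rewrite /g; case: pickP => //= p /eqP <- [<-].
  by have := fN p; rewrite inE.
rewrite -[leqLHS](card_ord (m i)).
have inj : injective (fun k : 'I_(m i) => f (Tagged (fun i => 'I_(m i)) k)).
  by move=> a b /f_inj /eqP; rewrite eq_Tagged => /eqP.
rewrite -(card_imset _ inj); apply/subset_leq_card/subsetP=> x.
by case/imsetP=> k _ ->; rewrite inE gf.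
Qed.

(** * Paths in the graph of a free group action *)

Section Action.
Variables (X : eqType) (V : eqType) (step : V -> X * bool -> V).
Hypothesis stepK : forall v l, step (step v l) (linv l) = v.
Implicit Types (v z : V) (l : X * bool) (w q : word X) (e : V * X).

Definition act v w := foldl step v w.

Lemma act_cat v w1 w2 : act v (w1 ++ w2) = act (act v w1) w2.
Proof. exact: foldl_cat. Qed.

Lemma actK v w : act (act v w) (winv w) = v.
Proof.
elim: w v => [|l w ih] v //=; rewrite winv_cons act_cat.
rewrite -/(act _ w) ih; exact: stepK.
Qed.

Lemma act_inj w : injective (act^~ w).
Proof. by apply: (@can_inj _ _ _ (act^~ (winv w))) => v; apply: actK. Qed.

(** An edge is recorded by the tail of its positive orientation, so that a letter and its inverse
    traverse the same edge. *)
Definition edge v l := (if l.2 then step v l else v, l.1).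

Lemma edge_linv v l : edge (step v l) (linv l) = edge v l.
Proof. by case: l => x []; rewrite /edge /= ?(stepK v (x, false)). Qed.

Fixpoint edges v w : seq (V * X) :=
  if w is l :: w' then edge v l :: edges (step v l) w' else [::].

Lemma size_edges v w : size (edges v w) = size w.
Proof. by elim: w v => //= l w ih v; rewrite ih. Qed.

Lemma edges_cat v w1 w2 : edges v (w1 ++ w2) = edges v w1 ++ edges (act v w1) w2.
Proof. by elim: w1 v => //= l w ih v; rewrite ih. Qed.

Lemma edges_winv v w : edges (act v w) (winv w) = rev (edges v w).
Proof.
elim: w v => //= l w ih v; rewrite winv_cons edges_cat -/(act _ w) ih.
by rewrite actK /= edge_linv rev_cons cats1.
Qed.

Lemma act_pow z q d k : act z (flatten (nseq d q)) = z ->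
  act z (flatten (nseq (k * d) q)) = z.
Proof.
move=> h; elim: k => // k ih.
by rewrite mulSn nseqD flatten_cat act_cat h ih.
Qed.

(** [d] is the least positive power of [q] fixing [z], that is, the size of the orbit of [z] under
    reading [q]. *)
Lemma act_order z q n : 0 < n -> act z (flatten (nseq n q)) = z ->
  exists d, [/\ 0 < d, d %| n, act z (flatten (nseq d q)) = z &
    forall k k', k < d -> k' < d ->
      act z (flatten (nseq k q)) = act z (flatten (nseq k' q)) -> k = k'].
Proof.
move=> n0 zn.
have ex : exists d, (0 < d) && (act z (flatten (nseq d q)) == z).
  by exists n; rewrite n0 zn eqxx.
case: (ex_minnP ex) => d /andP[d0 /eqP zd] dmin; exists d; split=> //.
  rewrite /dvdn; apply/negPn; rewrite -lt0n; apply/negP=> r0.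
  have /dmin : (0 < n %% d) && (act z (flatten (nseq (n %% d) q)) == z).
    rewrite r0 /=; apply/eqP; rewrite -[RHS]zn [in RHS](divn_eq n d).
    by rewrite nseqD flatten_cat act_cat act_pow.
  by rewrite leqNgt ltn_mod d0.
suff H k k' : k <= k' -> k' < d ->
    act z (flatten (nseq k q)) = act z (flatten (nseq k' q)) -> k = k'.
  move=> k k' kd k'd; case/orP: (leq_total k k') => kk' e; first exact: H.
  by apply/esym/H.
move=> kk' k'd e; apply/eqP; rewrite eqn_leq kk' leqNgt; apply/negP=> lt.
have /dmin : (0 < k' - k) && (act z (flatten (nseq (k' - k) q)) == z).
  rewrite subn_gt0 lt /=; apply/eqP; apply: (@act_inj (flatten (nseq k q))).
  by rewrite /= -act_cat -flatten_cat -nseqD subnK.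
by rewrite leqNgt (leq_ltn_trans (leq_subr _ _)).
Qed.

Lemma act_pow_mod z q d k : act z (flatten (nseq d q)) = z ->
  act z (flatten (nseq k q)) = act z (flatten (nseq (k %% d) q)).
Proof. by move=> zd; rewrite {1}(divn_eq k d) nseqD flatten_cat act_cat act_pow. Qed.

Lemma edges_pow z q k e :
  reflect (exists2 j, j < k & e \in edges (act z (flatten (nseq j q))) q)
    (e \in edges z (flatten (nseq k q))).
Proof.
elim: k => [|k ih]; first by right => -[].
rewrite -addn1 nseqD flatten_cat edges_cat mem_cat /= cats0.
apply: (iffP orP) => [[/ih[j jk ej]|ek]|[j]].
- by exists j; rewrite // ltn_addr.
- by exists k; rewrite // addn1.
rewrite addn1 ltnS leq_eqVlt => /orP[/eqP ->|jk] ej; first by right.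
by left; apply/ih; exists j.
Qed.

Lemma edges_cycle z q d k n : 0 < d -> act z (flatten (nseq d q)) = z ->
  {subset edges (act z (flatten (nseq k q))) (flatten (nseq n q)) <=
          edges z (flatten (nseq d q))}.
Proof.
move=> d0 zd e /edges_pow[j _]; rewrite -act_cat -flatten_cat -nseqD.
rewrite (act_pow_mod _ zd) => ej; apply/edges_pow.
by exists ((k + j) %% d); rewrite ?ltn_mod.
Qed.

(** * Holonomy of edge assignments *)

Section Holonomy.
Variable B : eqType.
Implicit Types (f : V * X -> word B) (S : seq (word B)).

Definition hol1 f v l := if l.2 then winv (f (edge v l)) else f (edge v l).

Fixpoint hol f v w : word B :=
  if w is l :: w' then hol1 f v l ++ hol f (step v l) w' else [::].

Lemma hol_cat f v w1 w2 : hol f v (w1 ++ w2) = hol f v w1 ++ hol f (act v w1) w2.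
Proof. by elim: w1 v => //= l w ih v; rewrite ih catA. Qed.

Lemma hol1_linv f v l : hol1 f (step v l) (linv l) = winv (hol1 f v l).
Proof. by rewrite /hol1 edge_linv; case: l => x [] /=; rewrite ?winvK. Qed.

Lemma hol_winv f v w : hol f (act v w) (winv w) = winv (hol f v w).
Proof.
elim: w v => //= l w ih v; rewrite winv_cons hol_cat -/(act _ w) ih.
by rewrite actK /= hol1_linv cats0 winv_cat.
Qed.

Lemma eq_in_hol f g v w : {in edges v w, f =1 g} -> hol f v w = hol g v w.
Proof.
elim: w v => //= l w ih v fg; rewrite ih => [|e ew]; last first.
  by apply: fg; rewrite inE ew orbT.
by rewrite /hol1 fg // mem_head.
Qed.

Lemma hol_pow S f z q d k : act z (flatten (nseq d q)) = z ->
  grp_eq S (hol f z (flatten (nseq d q))) [::] ->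
  grp_eq S (hol f z (flatten (nseq (k * d) q))) [::].
Proof.
move=> zd hd; elim: k => // k ih.
by rewrite mulSn nseqD flatten_cat hol_cat zd hd.
Qed.

Lemma hol_rot S f v w1 w2 : act v (w1 ++ w2) = v ->
  grp_eq S (hol f v (w1 ++ w2)) [::] ->
  grp_eq S (hol f (act v w1) (w2 ++ w1)) [::].
Proof.
move=> vw; rewrite !hol_cat => h; apply: grp_eq_conj.
by move: vw; rewrite act_cat => ->.
Qed.

(** The first edge is not met again, so its value is free to be the one that makes the product
    trivial; the sign of [l] decides whether the value or its inverse enters. *)
Lemma hol_solve S f g v l w :
  g =1 (fun e => if e == edge v l then
         if l.2 then hol f (step v l) w else winv (hol f (step v l) w) else f e) ->
  edge v l \notin edges (step v l) w ->
  grp_eq S (hol g v (l :: w)) [::].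
Proof.
move=> gE new /=.
have -> : hol g (step v l) w = hol f (step v l) w.
  apply: eq_in_hol => e ew; rewrite gE; case: eqP => // ee.
  by rewrite ee (negPf new) in ew.
by rewrite /hol1 gE eqxx; case: l.2; rewrite grp_mulVw.
Qed.

End Holonomy.
End Action.

(** * Combinatorics of words: rotated powers and overlapping factorizations *)

Lemma rot_pow (T : Type) j n (q : seq T) :
  exists2 q', size q' = size q & rot j (flatten (nseq n q)) = flatten (nseq n q').
Proof.
have rot1_pow (p : seq T) : rot 1 (flatten (nseq n p)) = flatten (nseq n (rot 1 p)).
  case: p => [|x p]; first by elim: n.
  case: n => [|n] //=; rewrite !rot1_cons -cats1 -catA.
  suff -> k : flatten (nseq k (x :: p)) ++ [:: x] = x :: flatten (nseq k (rcons p x)).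
    by rewrite -cats1 -catA.
  by elim: k => //= k ih; rewrite -catA ih cat_rcons.
elim: j => [|j [q' sq' ih]]; first by exists q; rewrite ?rot0.
case: (ltnP j (size (flatten (nseq n q)))) => jn.
  by exists (rot 1 q'); rewrite ?size_rot // -add1n rotD ?ih ?rot1_pow ?add1n.
by exists q; rewrite // rot_oversize // ltnW.
Qed.

(** This is Levi's lemma for the free monoid: two factorizations of one word have a common
    refinement. *)
Lemma cat_eq_cat (T : Type) (s t a b : seq T) : s ++ t = a ++ b ->
  (exists t1, t = t1 ++ b /\ a = s ++ t1) \/ (exists s1, s = a ++ s1 /\ b = s1 ++ t).
Proof.
elim: s a => [|x s ih] [|y a] /=; first by left; exists [::].
- by move=> ->; left; exists (y :: a).
- by move=> <-; right; exists (x :: s).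
case=> -> /ih[[t1 [-> ->]]|[s1 [-> ->]]]; first by left; exists t1.
by right; exists s1.
Qed.

(** * Perimeter of finite subgraphs and attachment of relator copies *)

Section Perimeter.
Variables (X I : finType) (V : eqType) (step : V -> X * bool -> V).
Hypothesis stepK : forall v l, step (step v l) (linv l) = v.
Variables (rel : I -> word X) (m : I -> nat) (g : X -> option I).
Hypothesis rel_closed : forall v i, act step v (rel i) = v.
Hypothesis gP : forall x i, g x = Some i -> x \in map fst (rel i).
Hypothesis g_card : forall i, m i <= #|[set x | g x == Some i]|.
Hypothesis m_gt0 : forall i, 0 < m i.
Notation act := (act step).
Notation edge := (edge step).
Notation edges := (edges step).
Implicit Types (v z b : V) (e : V * X) (Y : seq (V * X)).

Definition pos i x := index x (map fst (rel i)).
Definition letter i x := nth (x, false) (rel i) (pos i x).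

Definition side i b x := edge (act b (take (pos i x) (rel i))) (letter i x).

(* [base i] inverts [side i ^~ x]: it is the vertex from which reading [rel i]
   meets [e] at the first occurrence of the label of [e]. *)
Definition base i e :=
  act (if (letter i e.2).2 then step e.1 (e.2, false) else e.1)
    (winv (take (pos i e.2) (rel i))).

Lemma letter1 i x : x \in map fst (rel i) -> (letter i x).1 = x.
Proof.
move=> xi; have lt : pos i x < size (rel i) by rewrite -(size_map fst) index_mem.
by rewrite /letter -(nth_map _ x fst) // nth_index.
Qed.

Lemma side2 i b x : x \in map fst (rel i) -> (side i b x).2 = x.
Proof. exact: letter1. Qed.

Lemma sideK i b x : x \in map fst (rel i) -> base i (side i b x) = b.
Proof.
move=> xi; rewrite /base side2 //; set w := take _ _.
rewrite /side -/w /edge /=; have := letter1 xi.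
case: (letter i x) => y [] /= => [->|_]; last exact: actK.
by rewrite (stepK _ (x, true)) actK.
Qed.

Lemma side_edges i b x : x \in map fst (rel i) -> side i b x \in edges b (rel i).
Proof.
move=> xi; have lt : pos i x < size (rel i) by rewrite -(size_map fst) index_mem.
rewrite -[in edges _ _](cat_take_drop (pos i x) (rel i)) edges_cat mem_cat.
by rewrite (drop_nth (x, false) lt) /= inE eqxx orbT.
Qed.

Definition cell Y i b := all (mem Y) (edges b (rel i)).

Definition missing Y e := if g e.2 is Some i then ~~ cell Y i (base i e) else false.

Definition perim Y := size [seq e <- undup Y | missing Y e].

(** The competitors are the supergraphs of [Y] itself, so minimality passes to every supergraph
    whose perimeter is no larger. *)
Definition minimal Y := forall Y', {subset Y <= Y'} -> perim Y <= perim Y'.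

Lemma cell_sub Y Y' i b : {subset Y <= Y'} -> cell Y i b -> cell Y' i b.
Proof. by move=> YY' /allP cY; apply/allP=> e /cY/YY'. Qed.

Lemma missing_sub Y Y' e : {subset Y <= Y'} -> missing Y' e -> missing Y e.
Proof.
by rewrite /missing; case: g => // i YY'; apply: contraNN; apply: cell_sub.
Qed.

Lemma exists_minimal Y0 : exists Y, {subset Y0 <= Y} /\ minimal Y.
Proof.
have [n] := ubnP (perim Y0); elim: n Y0 => // n ih Y0 lt.
have [h|h] := EM (exists Y, {subset Y0 <= Y} /\ perim Y < perim Y0).
  case: h => Y [Y0Y lt']; have [|Y' [YY' min']] := ih Y.
    exact: leq_trans lt' _.
  by exists Y'; split=> // e /Y0Y/YY'.
exists Y0; split=> // Y Y0Y; rewrite leqNgt; apply/negP=> lt'.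
by apply: h; exists Y.
Qed.

Lemma exists_side i : exists x, g x = Some i.
Proof.
have /card_gt0P[x] := leq_trans (m_gt0 i) (g_card i).
by rewrite inE => /eqP; exists x.
Qed.

(** Every letter of a power occurs in its root, so the generators owned by [i], at least [m i] in
    number, all occur in [q]. *)
Lemma mult_root i n q : rel i = flatten (nseq n q) -> m i <= size q.
Proof.
move=> riE; apply: leq_trans (g_card i) _.
rewrite -(size_map fst); apply: leq_trans (card_size _).
apply/subset_leq_card/subsetP=> x; rewrite inE => /eqP/gP.
by case/mapP=> l; rewrite riE => /flattenP[u /nseqP[-> _]] lq ->; apply: map_f.
Qed.

(** Such an [f] has homotopy-invariant holonomy on the 2-complex made of [Y] and the relator copies
    contained in it. *)
Definition flat (B : eqType) (S : seq (word B)) (f : V * X -> word B) Y :=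
  forall i b, cell Y i b -> grp_eq S (hol step f b (rel i)) [::].

(* Attaching the cells along [q ^ d], all of whose letters outside [s] are
   already in [Y]: the [d] bases give [d * m i] pairwise distinct sides, none of
   which bounds a cell of [Y].  Minimality of [Y] forces equality in
   [new edges <= size s <= d * m i <= sides gained]; so the edges of [s] are new
   and pairwise distinct, and no other cell is completed. *)
Lemma attach_period Y z i j n d q s t :
  minimal Y -> rot j (rel i) = flatten (nseq n q) -> 0 < n ->
  0 < d -> d %| n ->
  act z (flatten (nseq d q)) = z ->
  (forall k k', k < d -> k' < d ->
     act z (flatten (nseq k q)) = act z (flatten (nseq k' q)) -> k = k') ->
  flatten (nseq d q) = s ++ t -> size s <= d * m i ->
  {subset edges (act z s) t <= Y} ->
  exists Y', [/\ {subset Y <= Y'}, perim Y' <= perim Y,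
    {subset edges z (flatten (nseq d q)) <= Y'} &
    forall (B : eqType) (S : seq (word B)) f, flat S f Y ->
      exists f', {in Y, f' =1 f} /\ flat S f' Y'].
Proof.
move=> minY rotE n0 d0 dn zd zinj qE sle tY.
pose zk k := act z (flatten (nseq k q)).
(* [O k] is the base of the copy of relator [i] that reaches [zk k] after [j] letters and then
   continues along the powers of [q]. *)
pose O k := act (zk k) (drop j (rel i)).
have OE k : act (O k) (take j (rel i)) = zk k.
  rewrite -act_cat -[drop j _ ++ _]/(rot j (rel i)) rotE -act_cat -flatten_cat -nseqD.
  by rewrite addnC nseqD flatten_cat act_cat -(divnK dn) act_pow.
have O_inj k k' : k < d -> k' < d -> O k = O k' -> k = k'.
  by move=> kd k'd /(act_inj stepK); apply: zinj.
have Oedges k : {subset edges (O k) (rel i) <= edges z (flatten (nseq d q))}.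
  move=> e; rewrite -[in rel i](cat_take_drop j (rel i)) edges_cat OE mem_cat orbC.
  rewrite -[O k]/(act (zk k) (drop j (rel i))) -mem_cat -edges_cat -/(rot j (rel i)) rotE.
  exact: edges_cycle.
case: (boolP (all (mem Y) (edges z (flatten (nseq d q))))) => [/allP allY|notY].
  by exists Y; split=> // B S f fl; exists f.
pose Y' := Y ++ edges z s.
have YY' : {subset Y <= Y'} by move=> e eY; rewrite mem_cat eY.
have dY' : {subset edges z (flatten (nseq d q)) <= Y'}.
  move=> e; rewrite qE edges_cat !mem_cat => /orP[->|/tY ->//].
  by rewrite orbT.
have OY' k : cell Y' i (O k) by apply/allP=> e /Oedges/dY'.
(* The copy based at [O k] runs through the whole cycle [q ^ d]; if it lay in [Y], so would that
   cycle. *)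
have OY k : k < d -> ~~ cell Y i (O k).
  move=> kd; apply: contra notY => /allP cY; apply/allP=> e ez; apply: cY.
  rewrite -[rel i](cat_take_drop j) edges_cat OE mem_cat orbC.
  rewrite -mem_cat -edges_cat -/(rot j (rel i)) rotE -(subnKC (dvdn_leq n0 dn)) //.
  rewrite nseqD flatten_cat edges_cat mem_cat; apply/orP; left.
  have zkd : act (zk k) (flatten (nseq d q)) = zk k.
    by rewrite -act_cat -flatten_cat -nseqD addnC nseqD flatten_cat act_cat zd.
  apply: (@edges_cycle _ _ _ _ _ _ (d - k) d _ zkd) => //.
  by rewrite -act_cat -flatten_cat -nseqD subnKC ?zd // ltnW.
(* [N] lists the added edges, [U] and [U'] the edges counted by the perimeter before and after, and
   [M] the owned sides of the [d] copies. The sides in [M] no longer count in [Y'], so [U'] and [M]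
   are disjoint parts of [U ++ N]. *)
pose N := [seq e <- undup (edges z s) | e \notin Y].
pose U := [seq e <- undup Y | missing Y e].
pose U' := [seq e <- undup Y' | missing Y' e].
pose M := [seq side i (O k) x | k <- iota 0 d, x <- enum [set x | g x == Some i]].
have MP e : reflect (exists k x, [/\ k < d, g x = Some i & e = side i (O k) x]) (e \in M).
  apply: (iffP allpairsP) => [[[k x] /= []]|[k [x [kd gx ->]]]].
    by rewrite mem_iota mem_enum inE => kd /eqP gx ->; exists k, x.
  by exists (k, x); rewrite mem_iota mem_enum inE gx.
have M_uniq : uniq M.
  apply: allpairs_uniq; rewrite ?iota_uniq ?enum_uniq // => -[k x] [k' x'] /=.
  case/allpairsP=> -[k1 x1] /= [+ + [-> ->]]; rewrite mem_iota mem_enum inE => k1d /eqP/gP x1i.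
  case/allpairsP=> -[k2 x2] /= [+ + [-> ->]]; rewrite mem_iota mem_enum inE => k2d /eqP/gP x2i.
  move=> e; have ex := congr1 snd e; rewrite !side2 // in ex.
  have := congr1 (base i) e; rewrite !sideK // => /O_inj -> //.
  by rewrite ex.
have M_size : d * m i <= size M.
  by rewrite size_allpairs size_iota -cardE leq_mul2l g_card orbT.
have UM_uniq : uniq (U' ++ M).
  rewrite cat_uniq M_uniq filter_uniq ?undup_uniq // andbT.
  apply/hasPn=> e /MP[k [x [kd gx ->]]] /=; rewrite mem_filter.
  by rewrite /missing side2 ?gP // gx sideK ?gP // OY'.
have newU e : e \in Y' -> missing Y e -> e \in U ++ N.
  rewrite !mem_cat !mem_filter !mem_undup => eY' -> /=.
  by case: (e \in Y) eY' => //= ->.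
have UM_sub : {subset U' ++ M <= U ++ N}.
  move=> e; rewrite mem_cat => /orP[|/MP[k [x [kd gx ->]]]].
    rewrite mem_filter mem_undup => /andP[mis eY'].
    by apply: newU => //; apply: missing_sub mis.
  apply: newU; last by rewrite /missing side2 ?gP // gx sideK ?gP // OY.
  by apply/dY'/(Oedges k)/side_edges/gP.
have N_le : size N <= size s.
  by rewrite -(size_edges step z s) size_filter (leq_trans (count_size _ _)) // size_undup.
have UM_le := uniq_leq_size UM_uniq UM_sub.
have perimY' := minY _ YY'.
have NM : size N <= size M by apply: leq_trans N_le (leq_trans sle M_size).
rewrite !size_cat -[size U']/(perim Y') -[size U]/(perim Y) in UM_le.
have MN : size M <= size N.
  by rewrite -(leq_add2l (perim Y)); apply: leq_trans UM_le; rewrite leq_add2r.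
have perimE : perim Y' <= perim Y.
  by rewrite -(leq_add2r (size M)); apply: leq_trans UM_le _; rewrite leq_add2l.
have N_eq : size N = size s.
  by apply/eqP; rewrite eqn_leq N_le (leq_trans sle) // (leq_trans M_size).
have s_uniq : uniq (edges z s).
  rewrite -[uniq _]negbK -ltn_size_undup size_edges -leqNgt -N_eq.
  by rewrite size_filter count_size.
have s_new : {in edges z s, forall e, e \notin Y}.
  apply/allP; rewrite -(eq_all_r (mem_undup _)) all_count.
  by rewrite -size_filter N_eq undup_id // size_edges.
have /(uniq_min_size UM_uniq UM_sub)[_ UM_eq] : size (U ++ N) <= size (U' ++ M).
  rewrite !size_cat.
  by rewrite -[size U']/(perim Y') -[size U]/(perim Y) leq_add.
exists Y'; split=> // B S f flatf.
case sE : s tY => [|l s'] tY.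
  by case/negP: notY; apply/allP=> e; rewrite qE sE; apply: tY.
move: s_uniq s_new; rewrite sE /= => /andP[l_new _] s_new.
(* The edge of [l] is traversed once along [q ^ d], so its value can be solved for. *)
pose h := hol step f (step z l) (s' ++ t).
pose f' e := if e == edge z l then if l.2 then h else winv h else f e.
have f'f : {in Y, f' =1 f}.
  move=> e eY; rewrite /f'; case: eqP => // ee.
  by have := s_new (edge z l); rewrite mem_head -ee eY => /(_ isT).
have z1 : grp_eq S (hol step f' z (flatten (nseq d q))) [::].
  rewrite qE sE; apply: (@hol_solve _ _ _ _ S f) => //.
  rewrite edges_cat mem_cat negb_or l_new; apply/negP=> lt.
  have := s_new (edge z l); rewrite mem_head => /(_ isT)/negP; apply.
  by apply: tY.
(* The loops [q ^ n] at [z] and at [zk k] are conjugate along [q ^ k]. *)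
have hol_zk k : grp_eq S (hol step f' (zk k) (flatten (nseq n q))) [::].
  have n1 : grp_eq S (hol step f' z (flatten (nseq n q))) [::].
    by rewrite -(divnK dn); apply: hol_pow.
  have zn : act z (flatten (nseq n q)) = z by rewrite -(divnK dn) act_pow.
  have := hol_cat step f' z (flatten (nseq k q)) (flatten (nseq n q)).
  rewrite -flatten_cat -nseqD addnC nseqD flatten_cat hol_cat zn => e.
  by rewrite -(grp_mulKw S (hol step f' z (flatten (nseq k q))) (hol _ _ (zk k) _)) -e n1 grp_mulVw.
exists f'; split=> // i' b cY'; have [cY|cY] := boolP (cell Y i' b).
  rewrite (eq_in_hol (g := f)); first exact: flatf.
  by move=> e eb; apply: f'f; apply: (allP cY).
(* A side of a newly completed copy lies in [U ++ N], hence in [U' ++ M]. It is not in [U'], its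
   copy being complete, so it is in [M] and the copy is based at some [O k]. *)
have [x gx] := exists_side i'.
have : side i' b x \in U' ++ M.
  rewrite UM_eq newU //; first by apply/(allP cY')/side_edges/gP.
  by rewrite /missing side2 ?gP // gx sideK ?gP.
rewrite mem_cat mem_filter /missing side2 ?gP // gx sideK ?gP // cY' /=.
case/MP=> k [x' [_ gx' e]]; have := congr1 snd e; rewrite !side2 ?gP // => ex.
rewrite -{x'}ex in gx' e; have ii : i' = i by move: gx'; rewrite gx => -[].
rewrite ii in e *; have := congr1 (base i) e; rewrite !sideK ?gP // => ->.
rewrite -[X in hol _ _ _ X](cat_take_drop j) -[O k]/(act (zk k) (drop j (rel i))).
apply: hol_rot; rewrite -/(rot j (rel i)) ?rotE ?hol_zk //.
by rewrite -rotE act_cat -/(O k) OE.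
Qed.

Lemma rel_rot_closed v i j : act v (rot j (rel i)) = v.
Proof.
apply: (act_inj stepK (w := drop j (rel i))).
by rewrite /= /rot act_cat -[LHS]act_cat cat_take_drop rel_closed.
Qed.

(** Reduction to a single period: the loop [q' ^ n] may run several times around the shorter cycle
    [q' ^ d], where [d] is the order of [z] under [q']. *)
Lemma attach_cycle Y z i n j q s t : minimal Y -> rel i = flatten (nseq n q) ->
  rot j (rel i) = s ++ t -> size s <= n * m i -> {subset edges (act z s) t <= Y} ->
  exists Y', [/\ {subset Y <= Y'}, perim Y' <= perim Y, {subset edges z s <= Y'} &
    forall (B : eqType) (S : seq (word B)) f, flat S f Y ->
      exists f', {in Y, f' =1 f} /\ flat S f' Y'].
Proof.
move=> minY riE rotE sle tY.
have n0 : 0 < n.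
  case: n riE {sle} => // riE; have [x /gP] := exists_side i.
  by rewrite riE.
have [q' sq' rotE'] := rot_pow j n q; rewrite -riE in rotE'.
have m_le : m i <= size q' by rewrite sq'; apply: mult_root riE.
have zn : act z (flatten (nseq n q')) = z by rewrite -rotE' rel_rot_closed.
have [d [d0 dn zd zinj]] := act_order stepK n0 zn.
have dle := dvdn_leq n0 dn.
have zA : act z (flatten (nseq (n - d) q')) = z.
  by rewrite -(divnK (dvdn_sub dn (dvdnn d))) act_pow.
have stE : s ++ t = flatten (nseq (n - d) q') ++ flatten (nseq d q').
  by rewrite -flatten_cat -nseqD subnK // -rotE'.
have sub_s : {subset edges z s <= edges z (flatten (nseq d q'))}.
  move=> e es; apply: (edges_cycle (k := 0) (n := n) d0 zd).
  by rewrite -rotE' rotE edges_cat mem_cat es.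
suff [s' [t' [qE s'le tY']]] : exists s' t', [/\ flatten (nseq d q') = s' ++ t',
    size s' <= d * m i & {subset edges (act z s') t' <= Y}].
  have [Y' [YY' pY' dY' ext]] := attach_period minY rotE' n0 d0 dn zd zinj qE s'le tY'.
  by exists Y'; split=> // e /sub_s/dY'.
(* The first [n - d] periods are split off. Either [s] ends within them and [t] contains a full
   cycle, which then lies in [Y], or [s] consists of these periods followed by [s']. *)
case/cat_eq_cat: stE => [[t1 [tE AE]]|[s' [sE DE]]].
  exists [::], (flatten (nseq d q')); split=> // e ed; apply: tY.
  by rewrite tE edges_cat -act_cat -AE zA mem_cat ed orbT.
exists s', t; split=> //.
  have sizeA : size (flatten (nseq (n - d) q')) = (n - d) * size q'.
    by rewrite size_flatten /shape map_nseq sumn_nseq mulnC.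
  (* As [m i <= size q'], the removed periods account for at least [(n - d) * m i] letters of [s],
     which leaves at most [d * m i] for [s']. *)
  rewrite -(leq_add2l ((n - d) * m i)) -mulnDl subnK //.
  apply: leq_trans sle; rewrite sE size_cat sizeA leq_add2r leq_mul2l m_le.
  by rewrite orbT.
by move: tY; rewrite sE act_cat zA.
Qed.

Lemma flat_rot (B : eqType) (S : seq (word B)) f Y z i j : flat S f Y ->
  {subset edges z (rot j (rel i)) <= Y} -> grp_eq S (hol step f z (rot j (rel i))) [::].
Proof.
move=> flatf cY; have := rel_rot_closed z i j; rewrite {1}/rot act_cat.
set b := act z (drop j (rel i)) => bz; rewrite -bz; apply: hol_rot.
  by rewrite cat_take_drop rel_closed.
rewrite cat_take_drop; apply: flatf; apply/allP=> e.
rewrite -[in rel i](cat_take_drop j (rel i)) edges_cat bz mem_cat orbC -mem_cat.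
by rewrite -edges_cat => /cY.
Qed.

Lemma attach_complement Y z i n j q u u' :
  minimal Y -> rel i = flatten (nseq n q) ->
  rot j (rel i) = u ++ u' \/ rot j (winv (rel i)) = u ++ u' ->
  size (winv u') <= n * m i -> {subset edges z u <= Y} ->
  act z u = act z (winv u') /\
  exists Y', [/\ {subset Y <= Y'}, perim Y' <= perim Y, {subset edges z (winv u') <= Y'} &
    forall (B : eqType) (S : seq (word B)) f, flat S f Y ->
      exists f', [/\ {in Y, f' =1 f}, flat S f' Y' &
        grp_eq S (hol step f' z u) (hol step f' z (winv u'))]].
Proof.
move=> minY riE rotE le uY.
(* [s] is the arc to be attached and [t] the arc already in [Y], both read positively along the
   relator from [y]. When [u] comes from the inverse relator, both arcs are inverted and the loop
   starts at [z] instead of [act z u]. *)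
have [j' [y [s [t [rotE' ys]]]]] : exists j' y s t, rot j' (rel i) = s ++ t /\
    ((y, s, t) = (act z u, u', u) \/ (y, s, t) = (z, winv u', winv u)).
  case: rotE => [e|e].
    exists (rot_add (rel i) j (size u)), (act z u), u', u; split; last by left.
    by rewrite -rot_rot_add e rot_size_cat.
  exists (size (drop j (winv (rel i)))), z, (winv u'), (winv u); split; last by right.
  have rE : rel i = winv (drop j (winv (rel i))) ++ winv (take j (winv (rel i))).
    by rewrite -winv_cat cat_take_drop winvK.
  by rewrite {2}rE -size_winv rot_size_cat -!winv_cat -/(rot j _) e.
have closed : act z (u ++ u') = z.
  case: ys => -[yE sE tE]; subst y s t.
    apply: (act_inj stepK (w := u)); rewrite /= -act_cat -catA -rotE'.
    by rewrite act_cat rel_rot_closed.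
  rewrite -[RHS](actK stepK z (winv (u ++ u'))) winvK winv_cat -rotE'.
  by rewrite rel_rot_closed.
have uE : act z u = act z (winv u').
  by rewrite -[in RHS]closed act_cat actK.
split=> //.
have u'E : act (act z u) u' = z by rewrite -act_cat.
have tY : {subset edges (act y s) t <= Y}.
  case: ys => -[-> -> ->]; first by rewrite u'E.
  by move=> e; rewrite -uE edges_winv // mem_rev => /uY.
have sle : size s <= n * m i by case: ys => -[_ -> _]; rewrite // -size_winv.
have [Y' [YY' pY' sY' ext]] := attach_cycle minY riE rotE' sle tY.
exists Y'; split=> // [|B S f /ext[f' [f'f flatf']]].
  case: ys => -[yE sE _]; move: sY'; rewrite yE sE // => sY' e.
  by rewrite -[z in edges z _]u'E edges_winv // mem_rev => /sY'.
exists f'; split=> //.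
have cyc : grp_eq S (hol step f' y (s ++ t)) [::].
  rewrite -rotE'; apply: flat_rot flatf' _ => e.
  by rewrite rotE' edges_cat mem_cat => /orP[/sY'|/tY/YY'].
have -> : hol step f' z (winv u') = winv (hol step f' (act z u) u').
  by rewrite -[z in hol _ _ z (winv _)]u'E hol_winv.
apply/grp_eq_mul1V; rewrite winvK -hol_cat.
case: ys => -[yE sE tE]; subst y s t.
  by have := hol_rot _ cyc; rewrite u'E; apply; rewrite act_cat u'E.
move: cyc; rewrite -winv_cat -[z in hol _ _ z _]closed hol_winv // => cyc.
by rewrite -[hol _ _ _ _]winvK cyc.
Qed.

(** Induction along the moves, for all [Y], [v] and [f] at once: a relator move enlarges [Y] and
    extends [f], and a cyclic reduction changes the base point. *)
Lemma null_holonomy w : clos_refl_trans_1n _ (move rel m) w [::] ->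
  forall Y v, minimal Y -> act v w = v -> {subset edges v w <= Y} ->
  forall (B : eqType) (S : seq (word B)) f, flat S f Y ->
    grp_eq S (hol step f v w) [::].
Proof.
suff H w' : clos_refl_trans_1n _ (move rel m) w w' -> w' = [::] ->
  forall Y v, minimal Y -> act v w = v -> {subset edges v w <= Y} ->
  forall (B : eqType) (S : seq (word B)) f, flat S f Y ->
    grp_eq S (hol step f v w) [::].
  by move=> h; apply: H h _.
elim=> {w w'} [w -> //|w w1 w' mv _ ih w'E Y v minY vw wY B S f flatf].
case: mv vw wY ih => [a b l|a l|i n j a b u u' [[q riE] _] rotE le] vw wY ih.
- rewrite hol_cat /= hol1_linv // grp_mulVKw stepK -hol_cat.
  apply: (ih w'E Y) => //; first by move: vw; rewrite !act_cat /= stepK.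
  move=> e ab; apply: wY; move: ab; rewrite !edges_cat !mem_cat /= stepK !inE.
  by case/orP=> ->; rewrite ?orbT.
(* The shortened loop is based at [step v l], and the original holonomy is its conjugate by that of
   [l]. *)
- have va : act (step v l) a = step v l.
    apply: (act_inj stepK (w := [:: linv l])).
    by rewrite /= stepK -[RHS]vw /= -cats1 act_cat.
  rewrite /= -cats1 hol_cat va /= cats0 hol1_linv //.
  rewrite (ih w'E Y _ minY va _ B S f) // ?grp_mulwV // => e ea.
  by apply: wY; rewrite /= -cats1 edges_cat inE mem_cat ea !orbT.
move: vw; rewrite !act_cat; set z := act v a => vw.
have uY : {subset edges z u <= Y}.
  by move=> e eu; apply: wY; rewrite !edges_cat !mem_cat eu orbT.
have [uE [Y' [YY' pY' u'Y' ext]]] := attach_complement minY riE rotE le uY.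
have [f' [f'f flatf' holE]] := ext B S f flatf.
have <- : hol step f' v (a ++ u ++ b) = hol step f v (a ++ u ++ b).
  by apply: eq_in_hol => e /wY/f'f.
rewrite !hol_cat -/z uE holE -hol_cat.
have -> : hol step f' v a ++ hol step f' z (winv u' ++ b) = hol step f' v (a ++ winv u' ++ b).
  by rewrite [RHS]hol_cat.
apply: (ih w'E Y') => //.
- by move=> Z YZ; apply: leq_trans pY' (minY _ _) => e /YY'/YZ.
- by rewrite !act_cat -/z -uE.
move=> e; rewrite !edges_cat !mem_cat -/z -uE => /or3P[ea|/u'Y'//|eb].
  by apply/YY'/wY; rewrite edges_cat mem_cat ea.
by apply/YY'/wY; rewrite !edges_cat !mem_cat eb !orbT.
Qed.

End Perimeter.

Lemma grp_eq_rel (A : eqType) (S : seq (word A)) r : r \in S -> grp_eq S r [::].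
Proof.
move=> rS; apply: rst_sym; apply: rst_step.
by have := gs_rel [::] [::] rS; rewrite /= cats0.
Qed.

(** * The Schreier graph of a finitely generated subgroup *)

Section Schreier.
Variables (X : choiceType) (S : seq (word X)) (k : nat) (h : 'I_k -> word X).
Implicit Types w : word X.

Lemma in_subgroup1 w : grp_eq S w [::] -> in_subgroup S h w.
Proof. by move=> w1; exists [::]. Qed.

Lemma in_subgroupM w1 w2 :
  in_subgroup S h w1 -> in_subgroup S h w2 -> in_subgroup S h (w1 ++ w2).
Proof. by move=> [u1 e1] [u2 e2]; exists (u1 ++ u2); rewrite subst_cat e1 e2. Qed.

Lemma in_subgroupV w : in_subgroup S h w -> in_subgroup S h (winv w).
Proof. by move=> [u e]; exists (winv u); rewrite winv_subst e. Qed.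

Lemma in_subgroup_eq w1 w2 :
  grp_eq S w1 w2 -> in_subgroup S h w1 -> in_subgroup S h w2.
Proof. by move=> e [u eu]; exists u; rewrite -e. Qed.

Definition same_coset w1 w2 := `[< in_subgroup S h (w1 ++ winv w2) >].

Definition rep w := choose (same_coset w) w.

Lemma same_cosetxx w : same_coset w w.
Proof. by apply/asboolP/in_subgroup1; rewrite grp_mulwV. Qed.

Lemma same_coset_sym w1 w2 : same_coset w1 w2 -> same_coset w2 w1.
Proof. by move=> /asboolP/in_subgroupV; rewrite winv_cat winvK => /asboolP. Qed.

Lemma same_coset_trans w1 w2 w3 :
  same_coset w1 w2 -> same_coset w2 w3 -> same_coset w1 w3.
Proof.
move=> /asboolP h1 /asboolP h2; apply/asboolP.
by apply: in_subgroup_eq (in_subgroupM h1 h2); rewrite -catA grp_mulKw.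
Qed.

Lemma rep_same w : same_coset w (rep w).
Proof. exact: chooseP (same_cosetxx w). Qed.

Lemma rep_eq w1 w2 : same_coset w1 w2 -> rep w1 = rep w2.
Proof.
move=> c; rewrite /rep; have e : same_coset w1 =1 same_coset w2.
  move=> w; apply/idP/idP; last exact: same_coset_trans.
  by apply: same_coset_trans; apply: same_coset_sym.
rewrite (eq_choose e); apply: choose_id; last exact: same_cosetxx.
exact: same_coset_sym.
Qed.

Lemma rep_idem w : rep (rep w) == rep w.
Proof. by apply/eqP/esym/rep_eq/rep_same. Qed.

(** The quotient is encoded as the type of chosen representatives, so that cosets form an [eqType]
    and equal cosets are equal terms. *)
Definition coset := {w : word X | rep w == w}.
Definition mkcoset w : coset := exist _ (rep w) (rep_idem w).

Lemma mkcosetP w1 w2 : mkcoset w1 = mkcoset w2 <-> same_coset w1 w2.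
Proof.
split=> [/(congr1 val) /= e|/rep_eq e]; last exact: val_inj.
by apply: same_coset_trans (rep_same _) _; rewrite e; apply/same_coset_sym/rep_same.
Qed.

Lemma mkcoset_val (v : coset) : mkcoset (val v) = v.
Proof. by apply: val_inj; apply/eqP; apply: (valP v). Qed.

Lemma mkcoset_cat w1 w2 w : mkcoset w1 = mkcoset w2 -> mkcoset (w1 ++ w) = mkcoset (w2 ++ w).
Proof.
move=> /mkcosetP/asboolP c; apply/mkcosetP/asboolP.
by apply: in_subgroup_eq c; rewrite winv_cat -catA grp_mulVKw.
Qed.

Definition coset_step (v : coset) l := mkcoset (val v ++ [:: l]).

Lemma act_mkcoset w1 w : act coset_step (mkcoset w1) w = mkcoset (w1 ++ w).
Proof.
elim: w w1 => [|l w ih] w1 /=; first by rewrite cats0.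
rewrite -cat1s catA -ih; congr (act _ _ _).
by apply: mkcoset_cat; rewrite mkcoset_val.
Qed.

Lemma mkcoset_eq w1 w2 : grp_eq S w1 w2 -> mkcoset w1 = mkcoset w2.
Proof.
by move=> e; apply/mkcosetP/asboolP/in_subgroup1; apply/grp_eq_mul1V.
Qed.

Lemma coset_act v w : grp_eq S w [::] -> act coset_step v w = v.
Proof.
move=> w1; rewrite -[v]mkcoset_val act_mkcoset; apply: mkcoset_eq.
by rewrite w1 cats0.
Qed.

Lemma coset_stepK v l : coset_step (coset_step v l) (linv l) = v.
Proof.
rewrite -[LHS]/(act coset_step v ([:: l] ++ winv [:: l])).
by apply: coset_act; rewrite grp_mulwV.
Qed.

Lemma coset_stab w :
  in_subgroup S h w <-> act coset_step (mkcoset [::]) w = mkcoset [::].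
Proof.
rewrite act_mkcoset; split=> [hw|/mkcosetP/asboolP]; last by rewrite cats0.
by apply/mkcosetP/asboolP; rewrite cats0.
Qed.

End Schreier.

(** * A finite presentation of the stabilizer of the base point *)

Section Stabilizer.
Variables (X : eqType) (V : eqType) (step : V -> X * bool -> V).
Hypothesis stepK : forall v l, step (step v l) (linv l) = v.
Implicit Types (e : V * X) (v : V).
Variables (S : seq (word X)) (Y : seq (V * X)) (v0 : V).
Variables (k : nat) (h : 'I_k -> word X).
Hypothesis S_closed : forall v r, r \in S -> act step v r = v.
Hypothesis stabE : forall w, in_subgroup S h w <-> act step v0 w = v0.
Hypothesis hY : forall i, {subset edges step v0 (h i) <= Y}.
Hypothesis null : forall w, grp_eq S w [::] -> {subset edges step v0 w <= Y} ->
  forall (B : eqType) (T : seq (word B)) f,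
  (forall v r, r \in S -> {subset edges step v r <= Y} ->
     grp_eq T (hol step f v r) [::]) ->
  grp_eq T (hol step f v0 w) [::].
Notation act := (act step).
Notation edge := (edge step).
Notation edges := (edges step).
Notation target e := (step e.1 (e.2, false)).

Let reach v := `[< exists w, {subset edges v0 w <= Y} /\ act v0 w = v >].

Let reach_act v w : reach v -> {subset edges v w <= Y} -> reach (act v w).
Proof.
move=> /asboolP[w0 [w0Y <-]] wY; apply/asboolP; exists (w0 ++ w).
rewrite act_cat; split=> // e; rewrite edges_cat mem_cat.
by case/orP=> [/w0Y|/wY].
Qed.

Let reach_step v l : edge v l \in Y -> reach (step v l) = reach v.
Proof.
move=> lY; apply/idP/idP => r.
  rewrite -[v](stepK v l) -[step _ _]/(act (step v l) [:: linv l]).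
  apply: reach_act r _ => e; rewrite inE => /eqP ->; by rewrite edge_linv.
by apply: (@reach_act v [:: l]) r _ => e; rewrite inE => /eqP ->.
Qed.

(** Taking the holonomy of [gen] and substituting [phi] are inverse to each other on loops of [Y] at
    [v0], the former modulo the finite list [T]; injectivity of [phi] modulo [T] comes from
    [null]. *)
Lemma stabilizer_fp : fp_subgroup S h.
Proof.
(* The paths [t v] are arbitrary except that [t v0] is empty, so that loops at [v0] are recovered
   without conjugation. *)
have /choice[t tP] v : exists w, (v = v0 -> w = [::]) /\
    (reach v -> {subset edges v0 w <= Y} /\ act v0 w = v).
  have [->|/eqP vv0] := eqVneq v v0; first by exists [::].
  have [/asboolP[w wP]|nr] := boolP (reach v); first by exists w.
  by exists [::]; split.
have t0 : t v0 = [::] by apply: (tP v0).1.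
pose Yr := [seq e <- undup Y | reach e.1].
have Yr_uniq : uniq Yr by rewrite filter_uniq ?undup_uniq.
pose tE (o : 'I_(size Yr)) := tnth (in_tuple Yr) o.
(* The default [[::]] makes the holonomy trivial along relator loops outside the component of
   [v0]. *)
pose gen e : word 'I_(size Yr) :=
  if insub (index e Yr) is Some o then [:: (o, false)] else [::].
pose phi o := t (tE o).1 ++ ((tE o).2, false) :: winv (t (target (tE o))).
have genE o : gen (tE o) = [:: (o, false)].
  rewrite /gen /tE (tnth_nth (tE o)) index_uniq //.
  by rewrite insubT //= => lt; congr [:: (_, _)]; apply: val_inj.
have genP e : e \in Y -> reach e.1 -> exists2 o, gen e = [:: (o, false)] & tE o = e.
  move=> eY er; have eYr : e \in in_tuple Yr by rewrite mem_filter er mem_undup.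
  by have /tnthP[o ->] := eYr; exists o => //; apply: genE.
have gen0 e : ~~ reach e.1 -> gen e = [::].
  move=> ner; rewrite /gen insubF // index_mem mem_filter (negPf ner) //.
have hol_gen v w : reach v -> {subset edges v w <= Y} ->
    grp_eq S (subst phi (hol step gen v w)) (t v ++ w ++ winv (t (act v w))).
  elim: w v => [|l w ih] v vr wY; first by rewrite /= grp_mulwV.
  have lY : edge v l \in Y by apply: wY; rewrite mem_head.
  rewrite /= subst_cat ih ?reach_step // => [|e ew]; last by apply: wY; rewrite inE ew orbT.
  suff -> : subst phi (hol1 step gen v l) = t v ++ l :: winv (t (step v l)).
    by rewrite -catA /= grp_mulKw.
  have [o oE tEo] : exists2 o, gen (edge v l) = [:: (o, false)] & tE o = edge v l.
    by apply: (genP _ lY); rewrite /edge /=; case: ifP => _; rewrite ?reach_step.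
  have phiE : subst phi [:: (o, false)] = phi o by rewrite /subst /= cats0.
  rewrite /hol1 oE; case: l lY oE tEo {wY} => x [] lY oE tEo; rewrite /= ?winv_subst phiE /phi tEo //=.
  have := stepK v (x, true); rewrite /linv /= => ->.
  by rewrite winv_cat winv_cons winvK -catA.
have hol_nreach v w : ~~ reach v -> {subset edges v w <= Y} -> hol step gen v w = [::].
  elim: w v => [|l w ih] v nr wY //=.
  have lY : edge v l \in Y by apply: wY; rewrite mem_head.
  rewrite ih ?reach_step // => [|e ew]; last by apply: wY; rewrite inE ew orbT.
  by rewrite /hol1 gen0 ?if_same ?cats0 //; rewrite /edge; case: ifP => _ /=; rewrite ?reach_step.
pose vs := [seq e.1 | e <- Y] ++ [seq target e | e <- Y].
(* Under [phi] the first relators become [t v ++ winv (t v)] and the others conjugates of relators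
   in [S], up to [grp_eq S]. *)
pose T := [seq hol step gen v0 (t v) | v <- vs & reach v] ++
  [seq hol step gen v r | r <- S, v <- [seq v <- vs | reach v && all (mem Y) (edges v r)]].
have vsP v l : edge v l \in Y -> v \in vs.
  rewrite mem_cat; case: l => x [] lY; apply/orP; [right|left].
    by apply/mapP; exists (step v (x, true), x) => //=; rewrite (stepK v (x, true)).
  by apply/mapP; exists (v, x).
have tree v : reach v -> v \in vs -> grp_eq T (hol step gen v0 (t v)) [::].
  move=> vr vvs; apply: grp_eq_rel; rewrite mem_cat; apply/orP; left.
  by apply: map_f; rewrite mem_filter vr.
have tEP o : [/\ tE o \in Y, reach (tE o).1 & reach (target (tE o))].
  have : tE o \in Yr by apply: mem_tnth.
  rewrite mem_filter mem_undup => /andP[er eY]; split=> //.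
  by rewrite reach_step // /edge /= -surjective_pairing.
(* Modulo [T] the two paths framing the edge have trivial holonomy, which leaves only the generator
   [o]. *)
have phiP o : [/\ act v0 (phi o) = v0, {subset edges v0 (phi o) <= Y} &
    grp_eq T (hol step gen v0 (phi o)) [:: (o, false)]].
  have [eY er tr] := tEP o; have [aY aE] := (tP _).2 er; have [bY bE] := (tP _).2 tr.
  have eE : edge (tE o).1 ((tE o).2, false) = tE o by rewrite [RHS]surjective_pairing.
  rewrite /phi act_cat aE /= -/(act _ _) edges_cat aE hol_cat aE /= eE.
  set y := step _ _ in tr bY bE *.
  have yA : act y (winv (t y)) = v0 by rewrite -{1}bE actK.
  have yE : edges y (winv (t y)) = rev (edges v0 (t y)) by rewrite -{1}bE edges_winv.
  have yH : hol step gen y (winv (t y)) = winv (hol step gen v0 (t y)).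
    by rewrite -{1}bE hol_winv.
  split=> //.
    move=> e; rewrite yE mem_cat inE mem_rev.
    by case/or3P=> [/aY|/eqP->|/bY].
  have e1 : (tE o).1 \in vs by apply: (@vsP _ ((tE o).2, false)); rewrite eE.
  have e2 : y \in vs.
    by apply: (@vsP _ ((tE o).2, true)); rewrite (edge_linv stepK _ (_, false)) eE.
  by rewrite yH (tree _ er e1) (tree _ tr e2) /hol1 /= eE genE.
have subst_phi u : [/\ act v0 (subst phi u) = v0, {subset edges v0 (subst phi u) <= Y} &
    grp_eq T (hol step gen v0 (subst phi u)) u].
  elim: u => [|[o b] u [ih1 ih2 ih3]]; first by split.
  rewrite /subst /= -/(subst phi u); set p := if b then _ else _.
  have [pE pY ph] : [/\ act v0 p = v0, {subset edges v0 p <= Y} &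
      grp_eq T (hol step gen v0 p) [:: (o, b)]].
    have [oE oY oh] := phiP o; rewrite /p; case: b {p} => //.
    split; first by rewrite -{1}oE actK.
      by move=> e; rewrite -{1}oE edges_winv // mem_rev => /oY.
    by rewrite -{1}oE hol_winv // oh.
  rewrite act_cat edges_cat hol_cat pE; split=> //; last by rewrite ph ih3.
  by move=> e; rewrite mem_cat => /orP[/pY|/ih2].
have cellP v r : r \in S -> {subset edges v r <= Y} -> reach v -> grp_eq T (hol step gen v r) [::].
  (* The empty relator has empty holonomy; a nonempty one has its first edge in [Y], which puts [v]
     in the finite list [vs]. *)
  case: r => // l r rS rY vr; apply: grp_eq_rel; rewrite mem_cat; apply/orP; right.
  apply/allpairsPdep; exists (l :: r), v; split=> //.
  rewrite mem_filter vr (@vsP _ l) ?andbT //; last by apply/rY/mem_head.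
  exact/allP.
exists (size Yr), T, phi; split; first by move=> o; apply/stabE; case: (phiP o).
split.
  move=> i; exists (hol step gen v0 (h i)); rewrite hol_gen //; last first.
    by apply/asboolP; exists [::].
  rewrite (stabE _).1 ?t0 ?cats0 //; exists [:: (i, false)].
  by rewrite /subst /= cats0.
move=> u; have [_ uY uE] := subst_phi u; split=> u1.
  (* The word [u] is, modulo [T], the holonomy of the loop [subst phi u], and this loop is trivial
     in the group. *)
  rewrite -uE; apply: null => // v r rS rY.
  by have [vr|nr] := boolP (reach v); [apply: cellP | rewrite hol_nreach].
rewrite -[[::]]/(subst phi [::]); apply: subst_grp_eq u1 => r.
rewrite mem_cat => /orP[/mapP[v]|/allpairsPdep[r' [v []]]].
  rewrite mem_filter => /andP[vr _] ->; have [tY tE'] := (tP _).2 vr.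
  rewrite hol_gen //; last by apply/asboolP; exists [::].
  by rewrite t0 tE' grp_mulwV.
move=> rS; rewrite mem_filter => /andP[/andP[vr /allP rY] _] ->.
by rewrite hol_gen // S_closed // (grp_eq_rel rS) grp_mulwV.
Qed.
End Stabilizer.

Theorem theorem6p1 (X I : finType) (rel : I -> word X) (m : I -> nat) :
  injective rel ->
  (forall i, cyc_reduced (rel i)) ->
  (forall i, 0 < m i) ->
  matching rel m ->
  (forall w : word X, grp_eq (map rel (enum I)) w [::] ->
     clos_refl_trans (word X) (move rel m) w [::]) ->
  coherent (map rel (enum I)).
Proof.
move=> _ _ m_gt0 /matching_assignment[g [gP g_card]] moves k h.
set S := map rel (enum I).
pose step := @coset_step X S k h.
have stepK := @coset_stepK X S k h; rewrite -/step in stepK.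
have relS i : rel i \in S by apply: map_f; rewrite mem_enum.
have rel_closed v i : act step v (rel i) = v by apply/coset_act/grp_eq_rel.
pose v0 := @mkcoset X S k h [::].
pose Y0 := flatten [seq edges step v0 (h i) | i <- enum 'I_k].
have [Y [Y0Y minY]] := exists_minimal step rel g Y0.
apply: (@stabilizer_fp X _ step stepK S Y v0) => [v r|w|i e eh|w w1 wY B T f flatf].
- by case/mapP=> i _ ->.
- exact: coset_stab.
- apply: Y0Y; apply/flattenP; exists (edges step v0 (h i)) => //.
  by apply: map_f; rewrite mem_enum.
(* This form of the closure exposes the first move, as the induction in [null_holonomy] requires. *)
have wmv := clos_rt_rt1n _ _ _ _ (moves w w1).
apply: (null_holonomy stepK rel_closed gP g_card m_gt0 wmv minY) => //.
  exact: coset_act.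
by move=> i b /allP cY; apply: flatf.
Qed.
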